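(* Let $(X,d,\mu)$, $\Omega$, $\theta\in[0,1)$, the boundary measure $\mathscr H$ on $\partial\Omega$, the double-phase function $\mathcal H$, the trace operator $T$ and the functional $\mathcal J_f$ be as in the context. Assume that $\Omega$ is bounded, that $\mathcal H$ satisfies the local comparability condition on $\overline\Omega$, that $\Omega$ supports the weak $(1,1)$-Poincaré inequality, and that $\Omega$ satisfies the global $\mathcal H$-Poincaré inequality. Let $f\in L^{\widetilde{\mathcal H}}(\partial\Omega)$ satisfy $\int_{\partial\Omega}f\,d\mathscr H=0$. Then $\mathcal J_f$ is coercive on $N^{1,\mathcal H}_*(\Omega)$, i.e. $\mathcal J_f(u_n)\to\infty$ for every sequence $(u_n)\subset N^{1,\mathcal H}_*(\Omega)$ with $\|u_n\|_{N^{1,\mathcal H}(\Omega)}\to\infty$.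
   Context: Setting. $(X,d,\mu)$ is a complete metric measure space, where $\mu$ is a $\sigma$-finite Borel regular measure with $0<\mu(B(x,r))<\infty$ for every open ball. $\Omega\subset X$ is a domain such that $0<\mu(B(x,r)\cap\Omega)<\infty$ for all $x\in\overline\Omega$, $r>0$, and $\mu$ satisfies the restricted doubling condition on $\Omega$: there is $C\ge1$ with $\mu(B(x,2r)\cap\Omega)\le C\mu(B(x,r)\cap\Omega)$ for all $x\in\overline\Omega$, $r>0$. $\mathscr H$ is a $\sigma$-finite Borel regular measure on $\partial\Omega$ satisfying, for a fixed $0\le\theta<1$, the upper codimension-$\theta$ condition: there is $C_\theta>0$ with $\mathscr H(B(x,r)\cap\partial\Omega)\le C_\theta\, r^{-\theta}\mu(B(x,r)\cap\Omega)$ for all $x\in\partial\Omega$, $r>0$. Double-phase function. $\mathcal H(x,\xi)=\xi^{p(x)}+a(x)\xi^{q(x)}$ for $x\in\overline\Omega$, $\xi\ge0$, where $p,q,a$ are measurable on $\overline\Omega$, $1<p(x)<q(x)<\infty$ for all $x$, $1<p^-:=\operatorname{ess\,inf}p\le p^+:=\operatorname{ess\,sup}p<\infty$, $1<q^-:=\operatorname{ess\,inf}q\le q^+:=\operatorname{ess\,sup}q<\infty$, and $0\le a\in L^\infty$. These conditions are assumed on $\overline\Omega$ with respect to $\mu$, and on $\partial\Omega$ with respect to $\mathscr H$. The complementary function is $\widetilde{\mathcal H}(x,\xi)=\sup_{s\ge0}\{s\xi-\mathcal H(x,s)\}$. Spaces. $L^{\mathcal H}(\Omega)$ is the space of measurable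 $u$ on $\Omega$ with $\varrho_{\mathcal H}(u)=\int_\Omega\mathcal H(x,|u|)\,d\mu<\infty$, with Luxemburg norm $\|u\|=\inf\{\tau>0:\varrho_{\mathcal H}(u/\tau)\le1\}$; $L^{\mathcal H}(\partial\Omega)$ and $L^{\widetilde{\mathcal H}}(\partial\Omega)$ are defined in the same way on $\partial\Omega$ with measure $\mathscr H$ and functions $\mathcal H$, $\widetilde{\mathcal H}$ respectively. Rectifiable curves are nonconstant, continuous, of finite length $\ell_\gamma$ and parametrized on $[0,\ell_\gamma]$. The $\mathcal H$-modulus of a family $\Gamma$ of rectifiable curves in $\Omega$ is $\inf\int_\Omega\mathcal H(x,h)\,d\mu$ over Borel $h\ge0$ (values in $[0,\infty]$) with $\int_\gamma h\,ds\ge1$ for all $\gamma\in\Gamma$ ($\infty$ if there is no such $h$). A nonnegative Borel function $g$ on $\Omega$ is an $\mathcal H$-weak upper gradient of a measurable $u:\Omega\to[-\infty,\infty]$ if $|u(\gamma(0))-u(\gamma(\ell_\gamma))|\le\int_\gamma g\,ds$ for all rectifiable curves $\gamma$ in $\Omega$ outside a family of $\mathcal H$-modulus zero (with $|(\pm\infty)-(\pm\infty)|=\infty$). If $u$ has an $\mathcal H$-weak upper gradient in $L^{\mathcal H}(\Omega)$, then $g_u$ denotes the minimal one ($g_u\le g$ $\mu$-a.e. for every $\mathcal H$-weak upper gradient $g\in L^{\mathcal H}(\Omega)$ of $u$), which exists and is $\mu$-a.e. unique. $N^{1,\mathcal H}(\Omega)$ is the (Banach) space of everywhere-defined $u\in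 L^{\mathcal H}(\Omega)$ having an $\mathcal H$-weak upper gradient in $L^{\mathcal H}(\Omega)$, with norm $\|u\|_{N^{1,\mathcal H}(\Omega)}=\|u\|_{L^{\mathcal H}(\Omega)}+\|g_u\|_{L^{\mathcal H}(\Omega)}$, modulo $u\sim v$ iff $\|u-v\|=0$. $N^{1,\mathcal H}_*(\Omega)=\{u\in N^{1,\mathcal H}(\Omega):\int_\Omega u\,d\mu=0\}$. Local comparability. $\mathcal H$ satisfies the local comparability condition on $E$ if there exist $C\ge1$ and $R_0>0$ such that for every ball $B\subset X$ of radius less than $R_0$, all $x,y\in B\cap E$ and all $\xi\in[0,\infty)$, $\mathcal H(x,\xi)\le C\,\mathcal H(y,C\xi)$. Weak $(1,1)$-Poincaré inequality. $\Omega$ supports it if there are $C>0$, $\lambda>1$ such that for every $u\in L^1_{\mathrm{loc}}(\Omega)$ (integrable on bounded subsets of $\Omega$) with minimal $\mathcal H$-weak upper gradient $g_u$, $\frac1{\mu(B)}\int_B|u-u_B|\,d\mu\le C r\frac1{\mu(\lambda B\cap\Omega)}\int_{\lambda B\cap\Omega}g_u\,d\mu$ for every ball $B=B(x,r)\subset\Omega$; by convention, this assumption includes the same inequality with $B$ replaced by $B\cap\Omega$ on the left-hand side (averages over $B\cap\Omega$) for every ball $B=B(x,r)$ with $x\in\overline\Omega$. Here $u_A=\frac1{\mu(A)}\int_A u\,d\mu$ and $\lambda B=B(x,\lambda r)$. Global $\mathcal H$-Poincaré inequality. There is $C>0$ with $\|u-u_\Omega\|_{L^{\mathcal H}(\Omega)}\le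 C\|g_u\|_{L^{\mathcal H}(\Omega)}$ for every $u\in N^{1,\mathcal H}(\Omega)$. Trace and energy. Under boundedness of $\Omega$, local comparability on $\overline\Omega$ and the weak $(1,1)$-Poincaré inequality, there is a bounded linear trace operator $T:N^{1,\mathcal H}(\Omega)\to L^{\mathcal H}(\partial\Omega)$ characterized by $\lim_{r\to0}\frac1{\mu(B(z,r)\cap\Omega)}\int_{B(z,r)\cap\Omega}|u-Tu(z)|\,d\mu=0$ for $\mathscr H$-a.e. $z\in\partial\Omega$. With $\mathcal A(x,\xi)=\frac{\xi^{p(x)}}{p(x)}+a(x)\frac{\xi^{q(x)}}{q(x)}$, set $$\mathcal J_f(u)=\int_\Omega\mathcal A(x,g_u)\,d\mu+\int_{\partial\Omega}f\,Tu\,d\mathscr H,\quad u\in N^{1,\mathcal H}(\Omega).$$ *)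

(* Defs.v *)
From HB Require Import structures.
From mathcomp Require Import all_boot all_order all_algebra.
From mathcomp Require Import all_classical all_reals all_analysis.
From mathcomp Require Import measurable_realfun.

Set Implicit Arguments.
Unset Strict Implicit.
Unset Printing Implicit Defensive.

Import Order.TTheory GRing.Theory Num.Theory.
Import numFieldNormedType.Exports.

Local Open Scope classical_set_scope.
Local Open Scope ring_scope.
Local Open Scope ereal_scope.

#[short(type="completeMetricType")]
HB.structure Definition CompleteMetric (R : numDomainType) :=
  {T of CompletePseudoMetric R T & Metric R T}.

Section musielak_orlicz.
Context d (Y : measurableType d) (R : realType).
Variable nu : {measure set Y -> \bar R}.
Implicit Types (D A : set Y) (u : Y -> \bar R).

(* [ess_sup] and [ess_inf] of the library, relative to the set [D]. *)
Definition ess_sup_on D (f : Y -> R) : \bar R :=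
  ereal_inf [set y | \forall x \ae nu, D x -> (f x)%:E <= y].

Definition ess_inf_on D (f : Y -> R) : \bar R :=
  ereal_sup [set y | \forall x \ae nu, D x -> y <= (f x)%:E].

(* "p^- <= p^+" is not listed: it is automatic when [nu D > 0], and fails
   under the conventions inf set0 = +oo, sup set0 = -oo when [nu D = 0]. *)
Definition double_phase_on D (p q a : Y -> R) : Prop :=
  [/\ [/\ measurable_fun D p, measurable_fun D q & measurable_fun D a],
      forall x, D x -> [/\ (1 < p x)%R, (p x < q x)%R & (0 <= a x)%R],
      1 < ess_inf_on D p /\ ess_sup_on D p < +oo,
      1 < ess_inf_on D q /\ ess_sup_on D q < +oo &
      ess_sup_on D a < +oo].

Variable Phi : Y -> \bar R -> \bar R.

Definition modular D u : \bar R := \int[nu]_(x in D) Phi x `|u x|.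

Definition in_LPhi D u : Prop := measurable_fun D u /\ modular D u < +oo.

Definition luxemburg_norm D u : \bar R :=
  ereal_inf [set tau%:E | tau in
    [set tau : R | (0 < tau)%R /\ modular D (fun x => (tau^-1)%:E * u x) <= 1]].

Definition average A u : \bar R :=
  ((fine (nu A))^-1)%:E * \int[nu]_(x in A) u x.

End musielak_orlicz.

Section double_phase.
Context (Y : Type) (R : realType) (p q a : Y -> R).

Definition Hfun (x : Y) (xi : \bar R) : \bar R :=
  xi `^ p x + (a x)%:E * xi `^ q x.

Definition Afun (x : Y) (xi : \bar R) : \bar R :=
  ((p x)^-1)%:E * xi `^ p x + (a x / q x)%:E * xi `^ q x.

Definition complementary (Phi : Y -> \bar R -> \bar R) (x : Y) (xi : \bar R) :
    \bar R :=
  ereal_sup [set s%:E * xi - Phi x s%:E | s in [set s : R | (0 <= s)%R]].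

End double_phase.

Section metric_measure.
Context (R : realType) (X : completeMetricType R).
Implicit Types (D A : set X) (mu : {outer_measure set X -> \bar R}).

(* A Borel regular measure is an outer measure defined on all sets, and
   "measurable" means Caratheodory measurable; [cmeasure mu] is the induced
   (complete) measure on the Caratheodory sigma-algebra. *)
Definition cmeasure mu : {measure set (caratheodory_type mu) -> \bar R} := mu.

Definition borel_regular mu : Prop :=
  <<s @open X >> `<=` mu.-caratheodory /\
  forall A, exists B, [/\ <<s @open X >> B, A `<=` B & mu B = mu A].

Definition boundary D : set X := closure D `\` D°.

Definition metric_bounded D : Prop := exists x r, D `<=` ball x r.

Definition domain D : Prop := [/\ D !=set0, open D & connected D].

Definition restricted_doubling mu D : Prop :=
  exists2 C : R, (1 <= C)%R & forall x (r : R), closure D x -> (0 < r)%R ->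
    mu (ball x (2 * r)%R `&` D) <= C%:E * mu (ball x r `&` D).

Definition upper_codimension mu (Hm : {outer_measure set X -> \bar R}) D
    (theta : R) : Prop :=
  exists2 C : R, (0 < C)%R & forall x (r : R), boundary D x -> (0 < r)%R ->
    Hm (ball x r `&` boundary D) <= (C * powR r (- theta))%:E * mu (ball x r `&` D).

Definition locally_comparable (Phi : X -> \bar R -> \bar R) D : Prop :=
  exists C R0 : R, [/\ (1 <= C)%R, (0 < R0)%R &
    forall z (r : R), (0 < r < R0)%R -> forall x y, ball z r x -> D x ->
      ball z r y -> D y -> forall xi : R, (0 <= xi)%R ->
      Phi x xi%:E <= C%:E * Phi y (C * xi)%:E].

Definition curve_length (gamma : R -> X) (s t : R) : \bar R :=
  ereal_sup [set (\sum_(0 <= i < size l)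
      mdist (gamma (nth t (s :: l) i)) (gamma (nth t (s :: l) i.+1)))%R%:E
    | l in itv_partition s t].

(* [(gamma, l)] stands for the restriction of [gamma] to [0, l], where [l] is
   the length of the curve and [gamma] is parametrized by arc length; then
   [0 < l] says that the curve is not constant. *)
Definition rectifiable_curve (c : (R -> X) * R) : Prop :=
  [/\ (0 < c.2)%R, {within `[0%R, c.2], continuous c.1} &
      forall s t : R, (0 <= s)%R -> (s <= t)%R -> (t <= c.2)%R ->
        curve_length c.1 s t = (t - s)%:E].

Definition curves_in D : set ((R -> X) * R) :=
  [set c | rectifiable_curve c /\
           forall t : R, (0 <= t <= c.2)%R -> D (c.1 t)].

Definition path_integral (c : (R -> X) * R) (h : X -> \bar R) : \bar R :=
  \int[lebesgue_measure]_(t in `[0%R, c.2]) h (c.1 t).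

Definition borel_fun D (g : X -> \bar R) : Prop :=
  @measurable_fun _ _ (g_sigma_algebraType (@open X)) (\bar R) D g.

Definition nonneg_borel D (g : X -> \bar R) : Prop :=
  borel_fun D g /\ forall x, D x -> 0 <= g x.

Section sobolev.
Context mu (Omega : set X) (Phi : X -> \bar R -> \bar R).
Implicit Types (u g h : X -> \bar R).

Let m := cmeasure mu.

Definition modulus (Gamma : set ((R -> X) * R)) : \bar R :=
  ereal_inf [set modular m Phi Omega h | h in
    [set h | nonneg_borel Omega h /\
             forall c, Gamma c -> 1 <= path_integral c h]].

(* In \bar R, both +oo - +oo and -oo - -oo are -oo, of absolute value +oo, as
   the definition of upper gradients requires. *)
Definition weak_upper_gradient u g : Prop :=
  nonneg_borel Omega g /\
  exists Gamma : set ((R -> X) * R),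
    [/\ Gamma `<=` curves_in Omega, modulus Gamma = 0 &
        forall c, curves_in Omega c -> ~ Gamma c ->
          `|u (c.1 0%R) - u (c.1 c.2)| <= path_integral c g].

Definition has_weak_upper_gradient u : Prop :=
  exists2 g, weak_upper_gradient u g & in_LPhi m Phi Omega g.

Definition is_min_weak_upper_gradient u g : Prop :=
  [/\ weak_upper_gradient u g, in_LPhi m Phi Omega g &
      forall g', weak_upper_gradient u g' -> in_LPhi m Phi Omega g' ->
        \forall x \ae m, Omega x -> g x <= g' x].

(* A choice of the minimal weak upper gradient, which exists and is a.e. unique
   as soon as [has_weak_upper_gradient u]. *)
Definition min_weak_upper_gradient u : X -> \bar R :=
  xget (cst 0) [set g | is_min_weak_upper_gradient u g].

(* Sobolev functions are represented by everywhere defined functions; only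
   their values on [Omega] matter. *)
Definition in_N1 u : Prop :=
  in_LPhi m Phi Omega u /\ has_weak_upper_gradient u.

Definition N1_norm u : \bar R :=
  luxemburg_norm m Phi Omega u +
  luxemburg_norm m Phi Omega (min_weak_upper_gradient u).

Definition in_N1_star u : Prop := in_N1 u /\ \int[m]_(x in Omega) u x = 0.

Definition locally_integrable u : Prop :=
  forall A, m.-cara.-measurable A -> A `<=` Omega -> metric_bounded A ->
    m.-integrable A u.

Definition weak_11_poincare : Prop :=
  exists C lambda : R, [/\ (0 < C)%R, (1 < lambda)%R &
    forall u, locally_integrable u -> has_weak_upper_gradient u ->
    forall x (r : R), (0 < r)%R ->
      let oscillation A := average m A (fun y => `|u y - average m A u|) in
      let bound := (C * r)%:E * average m (ball x (lambda * r)%R `&` Omega)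
                                          (min_weak_upper_gradient u) in
      (ball x r `<=` Omega -> oscillation (ball x r) <= bound) /\
      (closure Omega x -> oscillation (ball x r `&` Omega) <= bound)].

Definition global_poincare : Prop :=
  exists2 C : R, (0 < C)%R & forall u, in_N1 u ->
    luxemburg_norm m Phi Omega (fun x => u x - average m Omega u) <=
    C%:E * luxemburg_norm m Phi Omega (min_weak_upper_gradient u).

Context (Hm : {outer_measure set X -> \bar R}).

Let n := cmeasure Hm.

(* Bounded linear operator N^{1,Phi}(Omega) -> L^Phi(boundary Omega) determined
   by the limit of averages; linearity is an identity in L^Phi, i.e. Hm-a.e. *)
Definition trace_operator (T : (X -> \bar R) -> X -> \bar R) : Prop :=
  [/\ forall u, in_N1 u -> in_LPhi n Phi (boundary Omega) (T u),
      forall (c : R) u v, in_N1 u -> in_N1 v -> \forall z \ae n,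
        boundary Omega z ->
        T (fun x => c%:E * u x + v x) z = c%:E * T u z + T v z,
      exists2 C : R, (0 < C)%R & forall u, in_N1 u ->
        luxemburg_norm n Phi (boundary Omega) (T u) <= C%:E * N1_norm u &
      forall u, in_N1 u -> \forall z \ae n, boundary Omega z ->
        average m (ball z r `&` Omega) (fun x => `|u x - T u z|)
          @[r --> (0%R : R)^'+] --> (0 : \bar R)].

End sobolev.

Definition energy mu Hm (Omega : set X) (p q a : X -> R)
    (T : (X -> \bar R) -> X -> \bar R) (f u : X -> \bar R) : \bar R :=
  \int[cmeasure mu]_(x in Omega)
     Afun p q a x (min_weak_upper_gradient mu Omega (Hfun p q a) u x) +
  \int[cmeasure Hm]_(z in boundary Omega) (f z * T u z).

End metric_measure.

(* Main.v *)
Require Import Defs.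
From mathcomp Require Import all_boot all_order all_algebra.
From mathcomp Require Import all_classical all_reals all_analysis.
From mathcomp Require Import measurable_realfun.

(* On functions of mean zero the global Poincare inequality bounds the full
   norm by a multiple of N = ||g_u||.  Since H(x, t xi) >= t^s H(x, xi) for t >= 1
   and some s > 1 (s below the essential infimum of p), the interior energy is
   at least of order N^s.  By Young's inequality f w <= H~(x, f) + H(x, w),
   applied to w = Tu / tau with tau > ||Tu||, and by boundedness of T, the
   boundary term is at most of order N.  As s > 1, the former dominates. *)

Set Implicit Arguments.
Unset Strict Implicit.
Unset Printing Implicit Defensive.

Import Order.TTheory GRing.Theory Num.Theory.
Import numFieldNormedType.Exports.

Local Open Scope classical_set_scope.
Local Open Scope ring_scope.
Local Open Scope ereal_scope.

(** * Integration and measurability of extended-real functions *)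

Section integral_facts.
Context d (Y : measurableType d) (R : realType).
Context (nu : {measure set Y -> \bar R}).

(** The integral of a nonnegative function is a supremum over the simple functions below it, and
    this family grows with the function. The argument covers integrands whose measurability is
    unknown. *)
Lemma ge0_le_lower_integral (D : set Y) (f g : Y -> \bar R) :
  (forall x, D x -> 0 <= f x) -> (forall x, D x -> f x <= g x) ->
  \int[nu]_(x in D) f x <= \int[nu]_(x in D) g x.
Proof.
move=> f0 fg; rewrite !ge0_integralE//; last first.
  by move=> x Dx; exact: le_trans (f0 _ Dx) (fg _ Dx).
apply: ereal_sup_le => _ [h hf <-]; exists h => // x.
by apply: le_trans (hf x) _; exact: lee_restrict.
Qed.

(** Where the base is neither [0] nor [+oo], the power is the exponential of [p x] times a
    logarithm. At these two values a nonzero exponent returns the base itself. *)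
Lemma measurable_fun_poweR (D : set Y) (g : Y -> \bar R) (p : Y -> R) :
  measurable D -> measurable_fun D g -> measurable_fun D p ->
  (forall x, D x -> 0 <= g x) -> (forall x, D x -> p x != 0%R) ->
  measurable_fun D (fun x => g x `^ p x).
Proof.
move=> mD mg mp g0 p0.
have mfg : measurable_fun D (fine \o g) by exact: measurableT_comp.
have mE : measurable_fun D (fun x => (expR (p x * ln (fine (g x))))%:E).
  apply/measurable_EFinP; apply: measurableT_comp => //.
  apply: measurable_funM => //.
  exact: (measurableT_comp (@measurable_ln R)).
have me (c : \bar R) : measurable_fun D (fun x => g x == c).
  exact: measurable_fun_eqe.
apply: (eq_measurable_fun (fun x => if g x == +oo then +oo else
   if g x == 0 then 0 else (expR (p x * ln (fine (g x))))%:E)).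
  move=> x /set_mem Dx; move: (g0 _ Dx) (p0 _ Dx).
  case: (g x) => [r| |] //= r0 px; last by rewrite (negbTE px).
  by rewrite eqe /powR (negbTE px); case: ifP.
apply: measurable_fun_if => //.
apply: measurable_fun_if => //.
- exact: me.
- by apply: measurable_funS (me 0) => // x [].
- by apply: measurable_funS mE => // x [[]].
Qed.
End integral_facts.

(** * Pointwise estimates for the double-phase integrands *)

Section double_phase_facts.
Context (Y : Type) (R : realType) (p q a : Y -> R).
Implicit Types (x : Y) (xi : \bar R).

Lemma Hfun_ge0 x xi : (0 <= a x)%R -> 0 <= Hfun p q a x xi.
Proof.
by move=> a0; rewrite adde_ge0 ?poweR_ge0// mule_ge0 ?poweR_ge0// lee_fin.
Qed.

Lemma Afun_ge0 x xi : (0 <= p x)%R -> (0 <= q x)%R -> (0 <= a x)%R ->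
  0 <= Afun p q a x xi.
Proof.
move=> p0 q0 a0; rewrite adde_ge0// mule_ge0 ?poweR_ge0// lee_fin.
- by rewrite invr_ge0.
- by rewrite divr_ge0.
Qed.

(** The powers of [t >= 1] with exponents [p x] and [q x] dominate the one with exponent [s], so
    each phase gains at least that factor. *)
Lemma Hfun_superhomogeneous x xi (t s : R) : (0 <= a x)%R -> 0 <= xi ->
  (1 <= t)%R -> (s <= p x)%R -> (s <= q x)%R ->
  (t `^ s)%:E * Hfun p q a x xi <= Hfun p q a x (t%:E * xi).
Proof.
move=> a0 xi0 t1 sp sq; have t0 : (0 <= t)%R by exact: le_trans t1.
rewrite /Hfun !poweRM ?lee_fin// muleDr//; last first.
  by rewrite ge0_adde_def// inE ?mule_ge0 ?poweR_ge0// lee_fin.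
rewrite !poweR_EFin; apply: leeD.
  by rewrite lee_wpmul2r ?poweR_ge0// lee_fin ler_powR.
rewrite muleCA; apply: lee_wpmul2l; first by rewrite lee_fin.
by rewrite lee_wpmul2r ?poweR_ge0// lee_fin ler_powR.
Qed.

(** The reciprocals of [p x] and [q x] are at least that of [Q]. This bounds the energy density
    below by the modular density. *)
Lemma le_Hfun_Afun x xi (Q : R) : (0 <= a x)%R ->
  (0 < p x <= Q)%R -> (0 < q x <= Q)%R ->
  (Q^-1)%:E * Hfun p q a x xi <= Afun p q a x xi.
Proof.
move=> a0 /andP[p0 pQ] /andP[q0 qQ]; have Q0 := lt_le_trans p0 pQ.
rewrite /Hfun /Afun muleDr//; last first.
  by rewrite ge0_adde_def// inE ?mule_ge0 ?poweR_ge0// lee_fin.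
apply: leeD.
  by rewrite lee_wpmul2r ?poweR_ge0// lee_fin lef_pV2.
rewrite muleA -EFinM lee_wpmul2r ?poweR_ge0// lee_fin mulrC.
by rewrite ler_wpM2l// lef_pV2.
Qed.

Lemma Hfun_fin_num x xi : xi \is a fin_num -> Hfun p q a x xi \is a fin_num.
Proof.
by move=> fxi; rewrite fin_numD fin_numM ?fin_num_poweR.
Qed.

End double_phase_facts.

(** * Modulars and Luxemburg norms *)

Section luxemburg_facts.
Context d (Y : measurableType d) (R : realType).
Context (nu : {measure set Y -> \bar R}).
Context (D : set Y) (p q a : Y -> R).
Context (mD : measurable D).
Implicit Types (u f w : Y -> \bar R).

Lemma luxemburg_norm_ge0 (Phi : Y -> \bar R -> \bar R) u :
  0 <= luxemburg_norm nu Phi D u.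
Proof.
by apply: le_ereal_inf_tmp => _ [t [t0 _] <-]; rewrite lee_fin ltW.
Qed.

Lemma double_phase_exponents : double_phase_on nu D p q a ->
  exists s Q : R, [/\ (1 < s)%R, (0 < Q)%R &
    \forall x \ae nu, D x -> (s <= p x)%R /\ (q x <= Q)%R].
Proof.
move=> [_ _ [/ereal_sup_gt[y yp y1] _] [_ /ereal_inf_lt[z zq zoo]] _].
(* Over a null set the bounds may be [y = +oo] or [z = -oo]; arbitrary reals then serve. *)
have [s s1 sy] : exists2 s : R, (1 < s)%R & s%:E <= y.
  by case: y y1 {yp} => // [y|_]; [exists y|exists 2%R; rewrite ?leey ?ltr1n].
have [Q Q0 zQ] : exists2 Q : R, (0 < Q)%R & z <= Q%:E.
  case: z zoo {zq} => // [z _|_]; last by exists 1%R; rewrite ?leNye.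
  exists (`|z| + 1)%R; first exact: ltr_wpDl.
  by rewrite lee_fin ler_wpDr// ler_norm.
exists s, Q; split => //; move: yp zq; apply: filterS2 => x xp xq Dx.
by rewrite -!lee_fin (le_trans sy (xp Dx)) (le_trans (xq Dx) zQ).
Qed.

(** Carries the assumptions from the closure of the domain to the domain: on a smaller set more
    constants are almost everywhere bounds. *)
Lemma double_phase_onS (E : set Y) : measurable E -> D `<=` E ->
  double_phase_on nu E p q a -> double_phase_on nu D p q a.
Proof.
move=> mE DE [[mp mq ma] bnd [p1 poo] [q1 qoo] aoo].
have sup b : ess_sup_on nu D b <= ess_sup_on nu E b.
  by apply: ereal_inf_le_tmp => y; apply: filterS => x yb /DE/yb.
have inf b : ess_inf_on nu E b <= ess_inf_on nu D b.
  by apply: ereal_sup_le => y; apply: filterS => x yb /DE/yb.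
split.
- by split; exact: (measurable_funS mE DE).
- by move=> x /DE; exact: bnd.
- by split; [exact: lt_le_trans (inf p)|exact: le_lt_trans poo].
- by split; [exact: lt_le_trans (inf q)|exact: le_lt_trans qoo].
- exact: le_lt_trans aoo.
Qed.

Context (pqa : double_phase_on nu D p q a).

Lemma double_phase_bounds x : D x ->
  [/\ (0 < p x)%R, (p x <= q x)%R, (0 < q x)%R & (0 <= a x)%R].
Proof.
case: pqa => _ + _ _ _ Dx => /(_ x Dx)[p1 pq a0].
have p0 : (0 < p x)%R by exact: lt_trans p1.
by split => //; [exact: ltW|exact: lt_trans pq].
Qed.

Lemma measurable_fun_Hfun u : measurable_fun D u ->
  (forall x, D x -> 0 <= u x) ->
  measurable_fun D (fun x => Hfun p q a x (u x)).
Proof.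
have [[mp mq ma] _ _ _ _] := pqa => mu u0.
apply: emeasurable_funD.
  apply: measurable_fun_poweR => // x /double_phase_bounds[+ _ _ _].
  by move/gt_eqF/negbT.
apply: emeasurable_funM; first exact/measurable_EFinP.
apply: measurable_fun_poweR => // x /double_phase_bounds[_ _ + _].
by move/gt_eqF/negbT.
Qed.

Lemma measurable_fun_Afun u : measurable_fun D u ->
  (forall x, D x -> 0 <= u x) ->
  measurable_fun D (fun x => Afun p q a x (u x)).
Proof.
have [[mp mq ma] _ _ _ _] := pqa => mu u0.
(* The reciprocal of a positive function is the exponential of minus its logarithm. *)
have mV (b : Y -> R) : measurable_fun D b -> (forall x, D x -> (0 < b x)%R) ->
    measurable_fun D (fun x => (b x)^-1)%R.
  move=> mb b0.
  apply: (eq_measurable_fun (fun x => expR (- ln (b x)))%R).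
    by move=> x /set_mem Dx; rewrite expRN lnK// posrE b0.
  apply: measurableT_comp => //; apply: measurableT_comp => //.
  exact: (measurableT_comp (@measurable_ln R)).
apply: emeasurable_funD; apply: emeasurable_funM.
- by apply/measurable_EFinP/mV => // x /double_phase_bounds[].
- apply: measurable_fun_poweR => // x /double_phase_bounds[+ _ _ _].
  by move/gt_eqF/negbT.
- apply/measurable_EFinP/measurable_funM => //.
  by apply: mV => // x /double_phase_bounds[].
- apply: measurable_fun_poweR => // x /double_phase_bounds[_ _ + _].
  by move/gt_eqF/negbT.
Qed.

(** Being below the norm, [t] is not admissible, so the modular of [u / t] exceeds 1. Multiplying
    back by [t] gains the superhomogeneity factor. *)
Lemma powR_le_modular u (t s : R) : measurable_fun D u ->
  (\forall x \ae nu, D x -> (s <= p x)%R) -> (1 <= t)%R ->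
  t%:E < luxemburg_norm nu (Hfun p q a) D u ->
  (t `^ s)%:E <= modular nu (Hfun p q a) D u.
Proof.
move=> mu sp t1 tu; have t0 : (0 < t)%R by exact: lt_le_trans t1.
pose v x := (t^-1)%:E * u x.
have mv : measurable_fun D (fun x => `|v x|).
  by apply: measurableT_comp => //; exact: measurable_funeM.
have v1 : 1 <= modular nu (Hfun p q a) D v.
  rewrite leNgt; apply/negP => /ltW v1; move: tu; rewrite ltNge => /negP; apply.
  by apply: ereal_inf_lbound; exists t.
rewrite -[leLHS]mule1; apply: le_trans (lee_wpmul2l _ v1) _.
  by rewrite lee_fin powR_ge0.
rewrite /modular -ge0_integralZl_EFin ?powR_ge0//; last 2 first.
- by move=> x /double_phase_bounds[_ _ _]; exact: Hfun_ge0.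
- exact: measurable_fun_Hfun.
apply: ae_ge0_le_integral => //.
- move=> x /double_phase_bounds[_ _ _ a0].
  by rewrite mule_ge0 ?Hfun_ge0// lee_fin powR_ge0.
- by apply: measurable_funeM; exact: measurable_fun_Hfun.
- by move=> x /double_phase_bounds[_ _ _]; exact: Hfun_ge0.
- by apply: measurable_fun_Hfun => //; exact: measurableT_comp.
move: sp; apply: filterS => x sp Dx; have [_ pq _ a0] := double_phase_bounds Dx.
have -> : `|u x| = t%:E * `|v x|.
  rewrite abseM (gee0_abs (x := (t^-1)%:E)) ?lee_fin ?invr_ge0 ?ltW//.
  by rewrite muleA -EFinM divff ?gt_eqF// mul1e.
apply: Hfun_superhomogeneous => //; first exact: sp.
exact: le_trans (sp Dx) pq.
Qed.

(** Were the norm infinite, every [t >= 1] would lie below it, and the modular would dominate the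
    power of [t] with exponent [s > 1], hence every [t]. *)
Lemma luxemburg_norm_lty u : in_LPhi nu (Hfun p q a) D u ->
  luxemburg_norm nu (Hfun p q a) D u < +oo.
Proof.
move=> [mu]; have [s [Q [s1 _ sQ]]] := double_phase_exponents pqa.
have sp : \forall x \ae nu, D x -> (s <= p x)%R.
  by move: sQ; apply: filterS => x sQ /sQ[].
apply: contraTT; rewrite -!leNgt !leye_eq => /eqP uoo; apply/eqP/eqyP => A A0.
pose t := (Num.max 1 A)%R.
have t1 : (1 <= t)%R by rewrite le_max lexx.
apply: le_trans (powR_le_modular mu sp t1 _); last by rewrite uoo ltry.
rewrite lee_fin (@le_trans _ _ t) ?le_max ?lexx ?orbT//.
by apply: le1r_powR => //; exact: ltW.
Qed.

(* The complementary function need not be known to be measurable: only the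
   measurable minorant [maxe (F * W - H W) 0] of it is integrated. *)
Lemma ge0_integral_young f w (t : R) :
  measurable_fun D f -> measurable_fun D w ->
  luxemburg_norm nu (Hfun p q a) D w < t%:E ->
  \int[nu]_(x in D) `|f x * w x| <=
  t%:E * (modular nu (complementary (Hfun p q a)) D f + 1).
Proof.
(* The infimum defining the norm need not be attained, hence an admissible [tau] strictly below
   [t]. *)
move=> mf mw /ereal_inf_lt[_ [tau [tau0 tauw] <-]] ltau.
pose F x := `|f x|; pose W x := `|(tau^-1)%:E * w x|.
pose h x := maxe (F x * W x - Hfun p q a x (W x)) 0.
have mF : measurable_fun D F by exact: measurableT_comp.
have mW : measurable_fun D W.
  by apply: measurableT_comp => //; exact: measurable_funeM.
have mFW : measurable_fun D (F \* W) by exact: emeasurable_funM.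
have mH : measurable_fun D (fun x => Hfun p q a x (W x)).
  by apply: measurable_fun_Hfun => // x _; exact: abse_ge0.
have mh : measurable_fun D h.
  by apply: measurable_maxe => //; exact: emeasurable_funB.
have Hy x : D x -> Hfun p q a x +oo = +oo.
  move=> /double_phase_bounds[p0 _ _ a0].
  rewrite /Hfun poweRyr ?gt_eqF// addye// gt_eqF//.
  by apply: lt_le_trans (mule_ge0 _ (poweR_ge0 _ _)); rewrite ?ltNy0 ?lee_fin.
have h0 x : 0 <= h x by rewrite le_max lexx orbT.
(* For finite [W x], subtract and add back the finite value of [Hfun]; for infinite [W x] the
   right-hand side is [+oo]. *)
have FWh x : D x -> F x * W x <= h x + Hfun p q a x (W x).
  move=> Dx; have [Wf|] := boolP (W x \is a fin_num).
    rewrite -[leLHS](subeK _ (Hfun_fin_num p q a x Wf)); apply: leeD => //.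
    by rewrite le_max lexx.
  rewrite ge0_fin_numE ?abse_ge0// -leNgt leye_eq => /eqP ->.
  by rewrite Hy// addey ?leey// gt_eqF// (lt_le_trans _ (h0 x)) ?ltNy0.
(* In the supremum, the parameter [0] accounts for the truncation at zero and [W x] for the
   difference, which is [-oo] when [W x] is infinite. *)
have hc x : D x -> h x <= complementary (Hfun p q a) x `|f x|.
  move=> Dx; have [p0 _ q0 a0] := double_phase_bounds Dx.
  rewrite ge_max; apply/andP; split; last first.
    apply: ereal_sup_ubound; exists 0%R; first exact: lexx.
    by rewrite mul0e /Hfun !poweR0r ?gt_eqF// mule0 adde0 sube0.
  have : 0 <= W x by exact: abse_ge0.
  case: (W x) => // [r|_]; last by rewrite Hy// addeC leNye.
  by rewrite lee_fin => r0; apply: ereal_sup_ubound; exists r => //; rewrite muleC.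
(* The summand 1 bounds the modular of [w / tau], by admissibility of [tau]. *)
have int_le : \int[nu]_(x in D) (F x * W x) <=
    modular nu (complementary (Hfun p q a)) D f + 1.
  apply: (@le_trans _ _ (\int[nu]_(x in D) (h x + Hfun p q a x (W x)))).
    by apply: ge0_le_lower_integral => // x Dx; rewrite mule_ge0 ?abse_ge0.
  rewrite ge0_integralD//; last first.
    by move=> x /double_phase_bounds[_ _ _]; exact: Hfun_ge0.
  by apply: leeD => //; exact: ge0_le_lower_integral.
have -> : \int[nu]_(x in D) `|f x * w x| =
    tau%:E * \int[nu]_(x in D) (F x * W x).
  rewrite -ge0_integralZl_EFin ?ltW//; last first.
    by move=> x _; rewrite mule_ge0 ?abse_ge0.
  apply: eq_integral => x _; rewrite /F /W !abseM.
  rewrite (gee0_abs (x := (tau^-1)%:E)) ?lee_fin ?invr_ge0 ?ltW//.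
  by rewrite [RHS]muleCA [X in _ = _ * X]muleA -EFinM divff ?gt_eqF// mul1e.
have I0 : 0 <= \int[nu]_(x in D) (F x * W x).
  by apply: integral_ge0 => x _; rewrite mule_ge0 ?abse_ge0.
apply: le_trans (lee_wpmul2l _ int_le) _; first by rewrite lee_fin ltW.
by rewrite lee_wpmul2r ?(le_trans I0 int_le)// ltW.
Qed.

End luxemburg_facts.

(** * Superlinear growth against linear growth *)

Lemma powR_sub_linear_unbounded (R : realType) (s Q K M A : R) :
  (1 < s)%R -> (0 < Q)%R -> (0 <= K)%R -> (0 <= M)%R ->
  exists2 N0 : R, (2 <= N0)%R & forall N : R, (N0 <= N)%R ->
    (A <= Q^-1 * (N / 2) `^ s - (K * N + 1) * M)%R.
Proof.
(* With [t = N / 2 >= 1], the product [t * B] dominates [(K * N + 1) * M + A], so it suffices that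
   the power of [t] with exponent [s - 1] reach [Q * B]. *)
move=> s1 Q0 K0 M0; pose B := ((K * 2 + 1) * M + `|A|)%R.
have B0 : (0 <= B)%R by rewrite addr_ge0// mulr_ge0// addr_ge0// mulr_ge0.
have s10 : (0 < s - 1)%R by rewrite subr_gt0.
(* Twice the threshold for [t]: the maximum with 1 ensures [t >= 1], the other entry solves the
   requirement on the power. *)
exists (2 * Num.max 1 ((Q * B) `^ (s - 1)^-1))%R.
  by rewrite ler_peMr// le_max lexx.
move=> N; rewrite mulrC -ler_pdivlMr// ge_max => /andP[].
set t := (N / 2)%R => t1 QBt.
have -> : N = (t * 2)%R by rewrite /t divfK.
have t0 : (0 < t)%R by exact: lt_le_trans t1.
have Bt : (B <= Q^-1 * t `^ (s - 1))%R.
  rewrite -(ler_pM2l Q0) mulrA divff ?gt_eqF// mul1r.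
  have QB0 : (0 <= Q * B)%R by rewrite mulr_ge0// ltW.
  have := ge0_ler_powR (ltW s10) _ _ QBt.
  rewrite !nnegrE powR_ge0 ltW// -powRrM mulVf ?gt_eqF// powRr1//.
  exact.
have st : (t `^ s = t * t `^ (s - 1))%R.
  by rewrite mulr_powRB1// ?ltW// (lt_trans _ s1).
rewrite lerBrDr st [leRHS]mulrCA; apply: (@le_trans _ _ (t * B)%R); last first.
  by rewrite ler_pM2l.
rewrite /B [leRHS]mulrDr [leLHS]addrC; apply: lerD; last first.
  by apply: le_trans (ler_norm A) _; rewrite ler_peMl.
by rewrite [leRHS]mulrA ler_wpM2r// [leRHS]mulrDr mulr1 (mulrCA t) lerD.
Qed.

(** * Measurability of the domain and its boundary, and the chosen gradient *)

Lemma open_caratheodory_measurable (R : realType) (X : completeMetricType R)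
    (mu : {outer_measure set X -> \bar R}) (A : set X) :
  borel_regular mu -> open A -> mu.-cara.-measurable A.
Proof. by move=> [bm _] oA; apply: bm; exact: sub_sigma_algebra. Qed.

Lemma closure_caratheodory_measurable (R : realType)
    (X : completeMetricType R) (mu : {outer_measure set X -> \bar R})
    (A : set X) :
  borel_regular mu -> mu.-cara.-measurable (closure A).
Proof.
move=> bm; rewrite -(setCK (closure A)); apply: measurableC.
apply: open_caratheodory_measurable => //; rewrite openC.
exact: closed_closure.
Qed.

Lemma boundary_caratheodory_measurable (R : realType)
    (X : completeMetricType R) (mu : {outer_measure set X -> \bar R})
    (A : set X) :
  borel_regular mu -> mu.-cara.-measurable (boundary A).
Proof.
move=> bm; apply: measurableD; first exact: closure_caratheodory_measurable.
by apply: open_caratheodory_measurable => //; exact: open_interior.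
Qed.

(* If no minimal weak upper gradient existed, [min_weak_upper_gradient] would
   be its default value [cst 0], for which the conclusions hold as well. *)
Lemma min_weak_upper_gradient_in_LPhi (R : realType)
    (X : completeMetricType R) (mu : {outer_measure set X -> \bar R})
    (Omega : set X) (Phi : X -> \bar R -> \bar R) (u : X -> \bar R) :
  (forall x, Omega x -> Phi x 0 = 0) ->
  let g := min_weak_upper_gradient mu Omega Phi u in
  in_LPhi (cmeasure mu) Phi Omega g /\ (forall x, Omega x -> 0 <= g x).
Proof.
move=> Phi0; rewrite /min_weak_upper_gradient.
case: xgetP => [g _ [[[_ g0] _] gL _]|_]; first by split.
split=> //; split; first exact: measurable_cst.
rewrite /modular integral0_eq// => x Ox.
by rewrite /cst abse0 Phi0.
Qed.

(** * Coercivity of the energy on functions of mean zero *)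

Theorem proposition4p2 (R : realType) (X : completeMetricType R)
    (mu Hm : {outer_measure set X -> \bar R}) (Omega : set X) (theta : R)
    (p q a : X -> R) (T : (X -> \bar R) -> X -> \bar R) (f : X -> \bar R)
    (mu_sigma_finite : sigma_finite setT (cmeasure mu))
    (mu_borel_regular : borel_regular mu)
    (mu_ball : forall (x : X) (r : R), (0 < r)%R -> 0 < mu (ball x r) < +oo)
    (Omega_domain : domain Omega)
    (mu_ball_Omega : forall (x : X) (r : R), closure Omega x -> (0 < r)%R ->
       0 < mu (ball x r `&` Omega) < +oo)
    (mu_doubling : restricted_doubling mu Omega)
    (Hm_on_boundary : Hm (~` boundary Omega) = 0)
    (Hm_sigma_finite : sigma_finite setT (cmeasure Hm))
    (Hm_borel_regular : borel_regular Hm)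
    (theta_range : (0 <= theta < 1)%R)
    (Hm_codimension : upper_codimension mu Hm Omega theta)
    (pqa_mu : double_phase_on (cmeasure mu) (closure Omega) p q a)
    (pqa_Hm : double_phase_on (cmeasure Hm) (boundary Omega) p q a)
    (Omega_bounded : metric_bounded Omega)
    (H_comparable : locally_comparable (Hfun p q a) (closure Omega))
    (Omega_weak_poincare : weak_11_poincare mu Omega (Hfun p q a))
    (Omega_global_poincare : global_poincare mu Omega (Hfun p q a))
    (T_trace : trace_operator mu Omega (Hfun p q a) Hm T)
    (f_conjugate : in_LPhi (cmeasure Hm) (complementary (Hfun p q a))
                             (boundary Omega) f)
    (f_mean_zero : \int[cmeasure Hm]_(z in boundary Omega) f z = 0) :
  forall u : nat -> X -> \bar R,
    (forall n, in_N1_star mu Omega (Hfun p q a) (u n)) ->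
    N1_norm mu Omega (Hfun p q a) (u n) @[n --> \oo] --> +oo ->
    energy mu Hm Omega p q a T f (u n) @[n --> \oo] --> +oo.
Proof.
set Phi := Hfun p q a.
move=> u uN u_oo.
have mOmega : mu.-cara.-measurable Omega.
  by apply: open_caratheodory_measurable; [|case: Omega_domain].
have mbd : Hm.-cara.-measurable (boundary Omega).
  exact: boundary_caratheodory_measurable.
have sub : Omega `<=` closure Omega by exact: subset_closure.
have pqa_Omega : double_phase_on (cmeasure mu) Omega p q a.
  apply: double_phase_onS pqa_mu => //.
  exact: closure_caratheodory_measurable.
have [s [Q [s1 Q0 sQ]]] := double_phase_exponents pqa_Omega.
pose g n := min_weak_upper_gradient mu Omega Phi (u n).
have gL n : in_LPhi (cmeasure mu) Phi Omega (g n) /\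
    (forall x, Omega x -> 0 <= g n x).
  apply: min_weak_upper_gradient_in_LPhi => x.
  move=> /(double_phase_bounds pqa_Omega)[p0 _ q0 _].
  by rewrite /Phi /Hfun !poweR0r ?gt_eqF// mule0 adde0.
pose N n := fine (luxemburg_norm (cmeasure mu) Phi Omega (g n)).
have NE n : luxemburg_norm (cmeasure mu) Phi Omega (g n) = (N n)%:E.
  rewrite fineK// ge0_fin_numE ?luxemburg_norm_ge0//.
  exact: (luxemburg_norm_lty mOmega pqa_Omega (gL n).1).
have [CP CP0 poincare] := Omega_global_poincare.
(* [CP] accounts for the function, whose average vanishes, and 1 for its gradient. *)
have N1_le n : N1_norm mu Omega Phi (u n) <= ((CP + 1) * N n)%:E.
  have [uN1 u0] := uN n; have := poincare _ uN1.
  rewrite /average u0 mule0 (_ : (fun x => u n x - 0) = u n); last first.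
    by apply/funext => x; rewrite sube0.
  by rewrite NE /N1_norm -/(g n) NE mulrDl mul1r EFinD => ?; exact: leeD.
have [TL _ [CT CT0 Tbounded] _] := T_trace.
have [mf fL] := f_conjugate.
pose M := fine (modular (cmeasure Hm) (complementary Phi) (boundary Omega) f + 1).
(* The complementary function is nonnegative: the parameter [0] contributes the value [0] to its
   supremum. *)
have f_ge0 : 0 <= modular (cmeasure Hm) (complementary Phi) (boundary Omega) f.
  apply: integral_ge0 => z /(double_phase_bounds pqa_Hm)[p0 _ q0 _].
  apply: ereal_sup_ubound; exists 0%R; first exact: lexx.
  by rewrite mul0e /Phi /Hfun !poweR0r ?gt_eqF// mule0 adde0 sube0.
have ME : modular (cmeasure Hm) (complementary Phi) (boundary Omega) f + 1 = M%:E.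
  by rewrite fineK// fin_numD ge0_fin_numE// fL.
have M0 : (0 <= M)%R by rewrite -lee_fin -ME adde_ge0.
pose K := (CT * (CP + 1))%R.
have K0 : (0 <= K)%R by rewrite mulr_ge0 ?ltW ?addr_gt0.
have boundary_term n : - ((K * N n + 1) * M)%:E <=
    \int[cmeasure Hm]_(z in boundary Omega) (f z * T (u n) z).
  have [mTu _] := TL _ (uN n).1.
  (* The added 1 makes the inequality strict even when [N n] is zero, so that a finite admissible
     scale exists. *)
  have Tu_lt : luxemburg_norm (cmeasure Hm) Phi (boundary Omega) (T (u n)) <
      (K * N n + 1)%:E.
    apply: le_lt_trans (Tbounded _ (uN n).1) _.
    apply: le_lt_trans (lee_wpmul2l _ (N1_le n)) _; first by rewrite lee_fin ltW.
    by rewrite -EFinM lte_fin mulrA ltrDl.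
  have young := ge0_integral_young mbd pqa_Hm mf mTu Tu_lt.
  rewrite ME -EFinM in young.
  have := le_abse_integral (cmeasure Hm) mbd (emeasurable_funM mf mTu).
  by move=> /le_trans/(_ young); rewrite leeNl -abseN; exact/le_trans/lee_abs.
have interior_term n : (2 <= N n)%R -> (Q^-1 * (N n / 2) `^ s)%:E <=
    \int[cmeasure mu]_(x in Omega) Afun p q a x (g n x).
  move=> N2; have [[mg _] g0] := gL n.
  have sp : \forall x \ae cmeasure mu, Omega x -> (s <= p x)%R.
    by move: sQ; apply: filterS => x sQ /sQ[].
  (* Half the norm is strictly below it, and is at least 1 since [N n >= 2]. *)
  have := powR_le_modular mOmega pqa_Omega mg sp (t := (N n / 2)%R).
  rewrite ler_pdivlMr// mul1r NE lte_fin gtr_pMr ?(lt_le_trans _ N2)//.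
  rewrite invf_lt1// ltr1n => /(_ N2 isT) H.
  rewrite EFinM; apply: le_trans (lee_wpmul2l _ H) _.
    by rewrite lee_fin invr_ge0 ltW.
  have -> : modular (cmeasure mu) (Hfun p q a) Omega (g n) =
      \int[cmeasure mu]_(x in Omega) Hfun p q a x (g n x).
    by apply: eq_integral => x /set_mem Ox; rewrite gee0_abs// g0.
  have Qi0 : (0 <= Q^-1)%R by rewrite invr_ge0 ltW.
  rewrite -ge0_integralZl_EFin//; last 2 first.
  - by move=> x /(double_phase_bounds pqa_Omega)[_ _ _]; exact: Hfun_ge0.
  - exact: (measurable_fun_Hfun mOmega pqa_Omega).
  apply: ae_ge0_le_integral => //.
  - move=> x /(double_phase_bounds pqa_Omega)[_ _ _ a0].
    by rewrite mule_ge0 ?Hfun_ge0// lee_fin.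
  - by apply: measurable_funeM; exact: (measurable_fun_Hfun mOmega pqa_Omega).
  - move=> x /(double_phase_bounds pqa_Omega)[p0 _ q0 a0].
    by apply: Afun_ge0 => //; exact: ltW.
  - exact: (measurable_fun_Afun mOmega pqa_Omega).
  move: sQ; apply: filterS => x sQ Ox.
  have [p0 pq q0 a0] := double_phase_bounds pqa_Omega Ox.
  have [_ qQ] := sQ Ox.
  by apply: le_Hfun_Afun => //; rewrite ?p0 ?q0//= (le_trans pq).
apply/cvgeyPge => A.
have [N0 N02 large] := powR_sub_linear_unbounded A s1 Q0 K0 M0.
(* Once the full norm exceeds this level, [N1_le] forces [N n >= N0]. *)
move/cvgey_ge : u_oo => /(_ ((CP + 1) * N0)%R).
apply: filterS => n /le_trans/(_ (N1_le n)).
rewrite lee_fin ler_pM2l ?addr_gt0// => N0n.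
have := large _ N0n; rewrite -lee_fin => /le_trans; apply.
rewrite EFinB; apply: leeD; last exact: boundary_term.
by apply: interior_term; exact: le_trans N0n.
Qed.
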